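(* Fix $y\in Y$. The following statements are equivalent: (i) $\emptyset\neq\mathcal{K}\cap(\{y\}\times\mathbb{R})=\mathcal{M}\cap(\{y\}\times\mathbb{R})$; (ii) $\inf\{\langle x,c-y\rangle: Ax-b\in Q,\ x\in P\}=\max\{\langle b,w\rangle:-A^*w+c-y\in P^*,\ w\in Q^*\}$, where writing $\max$ means that the supremum is attained at some feasible $w$.
   Context: Setting: $(X,Y)$ and $(Z,W)$ are separated dual pairs of real vector spaces, i.e. there are bilinear forms on $X\times Y$ and on $Z\times W$, both denoted $\langle\cdot,\cdot\rangle$, such that $\langle x_0,y\rangle=0$ for all $y\in Y$ implies $x_0=0$, and $\langle x,y_0\rangle=0$ for all $x\in X$ implies $y_0=0$ (and likewise for $(Z,W)$). No topology is assumed. $A:X\to Z$ is a linear map with adjoint $A^*:W\to Y$, a linear map satisfying $\langle x,A^*w\rangle=\langle Ax,w\rangle$ for all $x\in X$, $w\in W$ (assumed to exist). $P\subset X$ and $Q\subset Z$ are convex cones (nonempty, and $\alpha u+\beta v$ is in the cone for all $\alpha,\beta\ge 0$ and $u,v$ in the cone); $b\in Z$, $c\in Y$. Dual cones: $P^*=\{y\in Y:\langle x,y\rangle\ge 0\ \forall x\in P\}$, $Q^*=\{w\in W:\langle q,w\rangle\ge 0\ \forall q\in Q\}$. Feasible sets: $F(\mathcal{P})=\{x\in P: Ax-b\in Q\}$ and $F(\mathcal{D})=\{w\in Q^*:-A^*w+c\in P^*\}$; both are assumed nonempty. Definitions: $\mathcal{K}=\bigcup_{w\in Q^*}\big((-A^*w+c-P^*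 )\times\,]-\infty,\langle b,w\rangle]\big)\subset Y\times\mathbb{R}$; $v_{\mathcal{P}}(y)=\inf\{\langle x,c-y\rangle:x\in F(\mathcal{P})\}$ for $y\in Y$ (possibly $-\infty$); $\mathcal{M}=\mathrm{hypo}\,v_{\mathcal{P}}=\{(y,r)\in Y\times\mathbb{R}: r\le v_{\mathcal{P}}(y)\}$. *)

(* Defs.v *)
From mathcomp Require Import all_boot all_order all_algebra.
From mathcomp Require Import boolp classical_sets set_interval reals constructive_ereal ereal sesquilinear.

Set Implicit Arguments.
Unset Strict Implicit.
Unset Printing Implicit Defensive.

Import Order.TTheory GRing.Theory Num.Theory.

Local Open Scope classical_set_scope.
Local Open Scope ring_scope.

(* The scaling laws [*%R & *%R] make a pairing linear over R in each argument,
   with values in R itself. *)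
Notation pairing R X Y := {bilinear X -> Y -> R | *%R & *%R}.

Definition separated_pairing (R : realType) (X Y : lmodType R)
    (p : pairing R X Y) : Prop :=
  (forall x0, (forall y, p x0 y = 0) -> x0 = 0) /\
  (forall y0, (forall x, p x y0 = 0) -> y0 = 0).

Definition adjoint (R : realType) (X Y Z W : lmodType R)
    (pXY : pairing R X Y) (pZW : pairing R Z W)
    (A : X -> Z) (As : W -> Y) : Prop :=
  forall x w, pXY x (As w) = pZW (A x) w.

Definition convex_cone (R : realType) (V : lmodType R) (C : set V) : Prop :=
  C !=set0 /\
  forall (a b : R) (u v : V),
    0 <= a -> 0 <= b -> C u -> C v -> C (a *: u + b *: v).

Definition dual_cone (R : realType) (X Y : lmodType R) (p : pairing R X Y)
    (P : set X) : set Y :=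
  [set y | forall x, P x -> 0 <= p x y].

Section ConicProgram.
Variables (R : realType) (X Y Z W : lmodType R).
Variables (pXY : pairing R X Y) (pZW : pairing R Z W).
Variables (A : X -> Z) (As : W -> Y) (P : set X) (Q : set Z) (b : Z) (c : Y).

Definition primal_feasible : set X := [set x | P x /\ Q (A x - b)].

Definition dual_feasible : set W :=
  [set w | dual_cone pZW Q w /\ dual_cone pXY P (- As w + c)].

Definition Kset : set (Y * R) :=
  \bigcup_(w in dual_cone pZW Q)
    ([set - As w + c - z | z in dual_cone pXY P] `*`
     [set` `]-oo, pZW b w]]).

Definition primal_value (y : Y) : \bar R :=
  ereal_inf [set (pXY x (c - y))%:E | x in primal_feasible].

Definition Mset : set (Y * R) :=
  [set yr | (yr.2%:E <= primal_value yr.1)%E].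

End ConicProgram.

(* Main.v *)
Require Import Defs.
From mathcomp Require Import all_boot all_order all_algebra.
From mathcomp Require Import boolp classical_sets set_interval reals constructive_ereal ereal sesquilinear.

Set Implicit Arguments.
Unset Strict Implicit.
Unset Printing Implicit Defensive.

Import Order.TTheory GRing.Theory Num.Theory.

Local Open Scope classical_set_scope.
Local Open Scope ring_scope.

(** The slice of [Kset] above [y] is the down-closure of the dual objective
    values: [(y, r)] lies in [Kset] exactly when some multiplier [w], feasible
    for the dual of the program with objective [c - y], satisfies
    [r <= pZW b w] ([Kset_fiberP]).  The slice of [Mset] above [y] is the set of
    reals below the primal value.  Weak duality ([weak_duality_gap] and its
    consequence [dual_objective_le_value]) says that the first slice is always
    contained in the second.

    The two slices coincide, and are not empty, precisely when there is no gap
    and the dual supremum is attained.  If they coincide, the primal value is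
    finite: a point of the slice bounds it from below, and a primal feasible
    point bounds it from above.  The value is then itself the top of the slice
    of [Mset], so it lies in the slice of [Kset] and is reached by a multiplier.
    Conversely, an optimal multiplier without gap is the top of both slices. *)

Section WeakDuality.
Variables (R : realType) (X Y Z W : lmodType R).
Variables (pXY : pairing R X Y) (pZW : pairing R Z W).
Variables (A : X -> Z) (As : W -> Y) (P : set X) (Q : set Z) (b : Z) (c : Y).

(** Adding and subtracting [pXY x (As w) = pZW (A x) w] splits the duality gap
    into two pairings; at feasible [x] and [w], each of them pairs an element of
    a cone with one of its dual cone, so the gap is nonnegative. *)
Lemma weak_duality_gap (hA : adjoint pXY pZW A As) (y : Y) (x : X) (w : W) :
  pXY x (c - y) - pZW b w = pXY x (- As w + c - y) + pZW (A x - b) w.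
Proof.
rewrite -addrA [in RHS]linearDr linearNr linearBl /= hA.
by rewrite [- _ + _ in RHS]addrC subrKA.
Qed.

Lemma dual_objective_le_value (hA : adjoint pXY pZW A As) (y : Y) (w : W) :
  dual_cone pZW Q w -> dual_cone pXY P (- As w + c - y) ->
  ((pZW b w)%:E <= primal_value pXY A P Q b c y)%E.
Proof.
move=> Qw Pw; apply: le_ereal_inf_tmp => _ [x [Px Qx] <-].
rewrite lee_fin -subr_ge0 (weak_duality_gap hA).
by apply: addr_ge0; [exact: Pw|exact: Qw].
Qed.

Lemma Kset_fiberP (y : Y) (r : R) :
  Kset pXY pZW As P Q b c (y, r) <->
  exists w, [/\ dual_cone pZW Q w, dual_cone pXY P (- As w + c - y) &
                r <= pZW b w].
Proof.
split=> [[w Qw [/= [z Pz zy]]]|[w [Qw Pw rw]]].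
  by rewrite in_itv /= => rw; exists w; split=> //; rewrite -zy subKr.
exists w => //; split=> /=; last by rewrite in_itv.
by exists (- As w + c - y); rewrite ?subKr.
Qed.

Lemma primal_value_fin (y : Y) (r : R) :
  primal_feasible A P Q b !=set0 -> Mset pXY A P Q b c (y, r) ->
  primal_value pXY A P Q b c y \is a fin_num.
Proof.
move=> [x Fx] rv; rewrite fin_real// (lt_le_trans (ltNyr r) rv)/=.
by apply: (le_lt_trans _ (ltry (pXY x (c - y)))); apply: ereal_inf_lbound; exists x.
Qed.

End WeakDuality.

Theorem theorem4p7 (R : realType) (X Y Z W : lmodType R)
    (pXY : pairing R X Y) (pZW : pairing R Z W)
    (hXY : separated_pairing pXY) (hZW : separated_pairing pZW)
    (A : {linear X -> Z}) (As : {linear W -> Y})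
    (hA : adjoint pXY pZW A As)
    (P : set X) (Q : set Z) (hP : convex_cone P) (hQ : convex_cone Q)
    (b : Z) (c : Y)
    (hFP : primal_feasible A P Q b !=set0)
    (hFD : dual_feasible pXY pZW As P Q c !=set0)
    (y : Y) :
  (Kset pXY pZW As P Q b c `&` ([set y] `*` [set: R]) !=set0 /\
   Kset pXY pZW As P Q b c `&` ([set y] `*` [set: R]) =
   Mset pXY A P Q b c `&` ([set y] `*` [set: R]))
  <->
  (exists2 w : W,
     dual_cone pZW Q w /\ dual_cone pXY P (- As w + c - y) &
     (forall w' : W, dual_cone pZW Q w' ->
        dual_cone pXY P (- As w' + c - y) -> pZW b w' <= pZW b w) /\
     ereal_inf [set (pXY x (c - y))%:E | x in [set x | Q (A x - b) /\ P x]] =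
       (pZW b w)%:E).
Proof.
have -> : [set x | Q (A x - b) /\ P x] = primal_feasible A P Q b.
  by apply/seteqP; split=> x [].
rewrite -/(primal_value pXY A P Q b c y); split.
- case=> [[[y1 r] [Kr [/= y1E _]]] KM]; rewrite {y1}y1E in Kr.
  have [Mr _] : (Mset pXY A P Q b c `&` [set y] `*` [set: R]) (y, r).
    by rewrite -KM.
  have vE := fineK (primal_value_fin hFP Mr).
  (* The value itself is a height of the slice of [Mset], hence of [Kset]. *)
  have [Kv _] : (Kset pXY pZW As P Q b c `&` [set y] `*` [set: R])
      (y, fine (primal_value pXY A P Q b c y)).
    by rewrite KM; split=> //; rewrite /Mset /= vE.
  have /Kset_fiberP[w [Qw Pw vw]] := Kv.
  have wE : primal_value pXY A P Q b c y = (pZW b w)%:E.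
    apply/eqP; rewrite eq_le (dual_objective_le_value _ hA)// andbT.
    by rewrite -vE lee_fin.
  exists w => //; split=> // w' Qw' Pw'.
  by rewrite -lee_fin -wE (dual_objective_le_value _ hA).
- case=> w [Qw Pw] [_ vE]; split.
    by exists (y, pZW b w); split=> //; apply/Kset_fiberP; exists w.
  apply/seteqP; split=> -[y1 r] [yrP [/= y1E _]]; rewrite {y1}y1E in yrP *.
    move: yrP => /Kset_fiberP[w' [Qw' Pw' rw']]; split=> //.
    rewrite /Mset /=; apply: (@le_trans _ _ (pZW b w')%:E).
      by rewrite lee_fin.
    exact: (dual_objective_le_value _ hA Qw' Pw').
  move: yrP; rewrite /Mset /= vE lee_fin => rw.
  by split=> //; apply/Kset_fiberP; exists w.
Qed.
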